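(* Let $\mathcal{O}$ be an orbifold, let $0\le k\le\dim\mathcal{O}$ and let $\mathcal{P}\subset\mathcal{O}$ be a subset. The following are equivalent. (i) $\mathcal{P}$ is a $k$-dimensional embedded suborbifold of $\mathcal{O}$. (ii) For every $p\in\mathcal{P}$ there is a chart $(U,\widetilde{U}/\Gamma,\pi)$ of $\mathcal{O}$ with the following property: there is a subgroup $\Delta\subset\Gamma$ and a connected $k$-dimensional $\Delta$-submanifold $\widetilde{V}\subset\widetilde{U}$ such that $\pi(\widetilde{V})$ is an open neighborhood of $p$ in $\mathcal{P}$ and, with $K$ denoting the kernel of the $\Delta$-action on $\widetilde{V}$, the canonical projection $\Delta\to\Delta/K$ has a right inverse which is a group homomorphism.
   Context: Manifolds are Hausdorff, second countable, smooth, without boundary and of constant finite dimension (not necessarily connected). ''Submanifold'' means embedded submanifold. $H$-submanifolds: for a Lie group $G$ (possibly finite), a $G$-manifold is a manifold with a smooth left $G$-action. If $H\subset G$ is a closed subgroup and $M$ is a $G$-manifold, an $H$-submanifold of $M$ is a submanifold $N\subset M$ with $N\cap Gx=Hx$ for every $x\in N$. Orbifolds: let $X$ be a second countable Hausdorff space. An $n$-dimensional orbifold chart on $X$ is a quadruple $(U,\widetilde{U}/\Gamma,\pi)$ where $U\subset X$ is open, $\Gamma$ is a finite group, $\widetilde{U}$ is a connected $n$-dimensional manifold with a smooth effective $\Gamma$-action, and $\pi\colon\widetilde{U}\to U$ is a continuous $\Gamma$-invariant map inducing a homeomorphism $\widetilde{U}/\Gamma\to U$. An injection from a chart $(V,\widetilde{V}/\Delta,\phi)$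 to a chart $(U,\widetilde{U}/\Gamma,\pi)$ with $V\subset U$ is a smooth embedding $\lambda\colon\widetilde{V}\to\widetilde{U}$ with $\pi\circ\lambda=\phi$. Two charts $(U_i,\widetilde{U}_i/\Gamma_i,\pi_i)$, $i=1,2$, are compatible in $p$ if there is a chart $(V,\widetilde{V}/\Delta,\phi)$ with $p\in V\subset U_1\cap U_2$ and injections from it into both charts. An $n$-dimensional orbifold atlas on $X$ is a collection of $n$-dimensional orbifold charts whose sets $U_\alpha$ cover $X$ and such that any two of them are compatible in every point of $U_\alpha\cap U_\beta$; every atlas is contained in a unique maximal atlas. An (effective) orbifold is a space $X$ together with a maximal orbifold atlas; a chart of (or on) the orbifold is an element of this maximal atlas. The orbifold and its underlying space are denoted by the same symbol. Embedded suborbifolds: a subset $\mathcal{P}\subset\mathcal{O}$ is an embedded $k$-dimensional suborbifold ($0\le k\le\dim\mathcal{O}$) if for every $p\in\mathcal{P}$ there are a chart $(U,\widetilde{U}/\Gamma,\pi)$ of $\mathcal{O}$, a subgroup $\Delta\subset\Gamma$ and a connected $k$-dimensional $\Delta$-submanifold $\widetilde{V}\subset\widetilde{U}$ such that $\pi(\widetilde{V})$ is an open neighborhood of $p$ in $\mathcal{P}$ and the action of $\Delta$ on $\widetilde{V}$ is effective. *)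

(* Defs.v *)
From HB Require Import structures.
From mathcomp Require Import all_boot all_order all_algebra all_fingroup.
From mathcomp Require Import generic_quotient.
From mathcomp Require Import all_classical all_reals all_analysis.

Set Implicit Arguments.
Unset Strict Implicit.
Unset Printing Implicit Defensive.

Import Order.TTheory GRing.Theory Num.Theory.
Import numFieldNormedType.Exports.

Local Open Scope classical_set_scope.
Local Open Scope ring_scope.

(* Continuous injection that is open onto its range (a homeomorphism onto the
   range with the subspace topology). *)
Definition topological_embedding (S T : topologicalType) (f : S -> T) : Prop :=
  [/\ continuous f, injective f &
      forall A : set S, open A ->
        exists2 B : set T, open B & f @` A = B `&` range f].

Definition open_neighborhood_in (T : topologicalType) (P : set T) (p : T)
    (A : set T) : Prop :=
  A p /\ exists2 W : set T, open W & A = W `&` P.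

(* C^k maps on D, by existence and continuity of iterated partial derivatives.
   Only meant for open D. *)
Fixpoint Ck_on (R : realType) (m n k : nat) (D : set 'rV[R]_m)
    (f : 'rV[R]_m -> 'rV[R]_n) : Prop :=
  match k with
  | 0 => {in D, continuous f}
  | k'.+1 => {in D, continuous f} /\
      forall i : 'I_m,
        (forall x, D x -> derivable f x (delta_mx 0 i)) /\
        Ck_on k' D (fun x => 'D_(delta_mx 0 i) f x)
  end.

Definition smooth_on (R : realType) (m n : nat) (D : set 'rV[R]_m)
    (f : 'rV[R]_m -> 'rV[R]_n) : Prop :=
  forall k, Ck_on k D f.

(* A homeomorphism from an open subset of M to an open subset of R^n; the
   values of [mc_map] off [mc_dom], and of [mc_inv] off the image of [mc_dom],
   are irrelevant. *)
Record mchart (R : realType) (n : nat) (M : topologicalType) := MChart {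
  mc_dom : set M;
  mc_map : M -> 'rV[R]_n;
  mc_inv : 'rV[R]_n -> M;
  mc_open_dom : open mc_dom;
  mc_open_img : open (mc_map @` mc_dom);
  mc_mapK : {in mc_dom, cancel mc_map mc_inv};
  mc_map_continuous : {in mc_dom, continuous mc_map};
  mc_inv_continuous : {in mc_map @` mc_dom, continuous mc_inv}
}.

Definition mchart_transition_smooth (R : realType) (n : nat)
    (M : topologicalType) (c d : mchart R n M) : Prop :=
  smooth_on (mc_map c @` (mc_dom c `&` mc_dom d)) (mc_map d \o mc_inv c).

Record manifold (R : realType) (n : nat) := Manifold {
  m_space :> topologicalType;
  m_hausdorff : hausdorff_space m_space;
  m_second_countable : @second_countable m_space;
  m_atlas : set (mchart R n m_space);
  m_atlas_cover : forall x : m_space, exists2 c, m_atlas c & mc_dom c x;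
  m_atlas_compatible : forall c d, m_atlas c -> m_atlas d ->
    mchart_transition_smooth c d
}.

(* The charts of the maximal atlas. *)
Definition smooth_chart (R : realType) (n : nat) (M : manifold R n)
    (c : mchart R n M) : Prop :=
  forall d, m_atlas d ->
    mchart_transition_smooth c d /\ mchart_transition_smooth d c.

Section SmoothMaps.
Variables (R : realType) (m n : nat) (M : manifold R m) (N : manifold R n).

Definition in_charts (f : M -> N) (c : mchart R m M) (d : mchart R n N) :
    'rV[R]_m -> 'rV[R]_n :=
  mc_map d \o f \o mc_inv c.

Definition smooth (f : M -> N) : Prop :=
  continuous f /\
  forall c d, m_atlas c -> m_atlas d ->
    smooth_on (mc_map c @` (mc_dom c `&` f @^-1` mc_dom d)) (in_charts f c d).

(* [jacobian] acts on row vectors from the right, so that [row_free] says that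
   the differential is injective. *)
Definition immersion (f : M -> N) : Prop :=
  smooth f /\
  forall c d (x : M), m_atlas c -> m_atlas d -> mc_dom c x -> mc_dom d (f x) ->
    row_free (jacobian (in_charts f c d) (mc_map c x)).

Definition smooth_embedding (f : M -> N) : Prop :=
  immersion f /\ topological_embedding f.

End SmoothMaps.

(* k-dimensional embedded submanifolds, by slice charts. *)
Definition submanifold (R : realType) (n k : nat) (M : manifold R n)
    (N : set M) : Prop :=
  (k <= n)%N /\
  forall p, N p -> exists c : mchart R n M,
    [/\ smooth_chart c, mc_dom c p &
        forall x, mc_dom c x ->
          (N x <-> forall i : 'I_n, (k <= i)%N -> mc_map c x 0 i = 0)].

(* Smooth left actions of a finite (hence discrete) group. *)
Record smooth_action (R : realType) (n : nat) (gT : finGroupType)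
    (M : manifold R n) := SmoothAction {
  sa_fun :> gT -> M -> M;
  sa_1 : forall x, sa_fun 1%g x = x;
  sa_M : forall g h x, sa_fun (g * h)%g x = sa_fun g (sa_fun h x);
  sa_smooth : forall g, smooth (sa_fun g)
}.

Section Actions.
Variables (R : realType) (n : nat) (gT : finGroupType) (M : manifold R n).
Variable a : smooth_action gT M.

Definition act_orbit (H : {group gT}) (x : M) : set M :=
  [set y | exists2 h, h \in H & y = a h x].

Definition effective_on (H : {group gT}) (N : set M) : Prop :=
  forall h, h \in H -> (forall x, N x -> a h x = x) -> h = 1%g.

Definition H_submanifold (k : nat) (H : {group gT}) (N : set M) : Prop :=
  submanifold k N /\
  forall x, N x -> N `&` act_orbit [set: gT]%G x = act_orbit H x.

Definition act_kernel (H : {group gT}) (N : set M) : {set gT} :=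
  [set h in H | `[< forall x, N x -> a h x = x >]]%SET.

Lemma act_kernel_group_set (H : {group gT}) (N : set M) :
  group_set (act_kernel H N).
Proof.
apply/group_setP; split=> [|g h].
  by rewrite inE group1; apply/asboolP => x _; exact: sa_1.
rewrite !inE => /andP[Hg /asboolP ag] /andP[Hh /asboolP ah].
by rewrite groupM//; apply/asboolP => x Nx; rewrite sa_M ah// ag.
Qed.
Canonical act_kernel_group (H : {group gT}) (N : set M) : {group gT} :=
  Group (act_kernel_group_set H N).

Definition same_orbit (x y : M) : bool := `[< act_orbit [set: gT]%G x y >].

Lemma same_orbit_refl : reflexive same_orbit.
Proof. by move=> x; apply/asboolP; exists 1%g; rewrite ?inE ?sa_1. Qed.

Lemma same_orbit_sym : symmetric same_orbit.
Proof.
have imp x y : same_orbit x y -> same_orbit y x.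
  move=> /asboolP[g _ ->]; apply/asboolP; exists g^-1%g; rewrite ?inE//.
  by rewrite -sa_M mulVg sa_1.
by move=> x y; apply/idP/idP; exact: imp.
Qed.

Lemma same_orbit_trans : transitive same_orbit.
Proof.
move=> y x z /asboolP[g _ ->] /asboolP[h _ ->]; apply/asboolP.
by exists (h * g)%g; rewrite ?inE ?sa_M.
Qed.

Definition orbit_equiv : equiv_rel M :=
  EquivRel same_orbit same_orbit_refl same_orbit_sym same_orbit_trans.

Definition orbit_space : topologicalType :=
  quotient_topology {eq_quot orbit_equiv}%qT.

Definition orbit_proj (x : M) : orbit_space :=
  (\pi_({eq_quot orbit_equiv}%qT) x)%qT.

End Actions.

Record orbichart (R : realType) (n : nat) (X : topologicalType) := OrbiChart {
  oc_dom : set X;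
  oc_open_dom : open oc_dom;
  oc_group : finGroupType;
  oc_cover : manifold R n;
  oc_cover_connected : connected [set: oc_cover];
  oc_act : smooth_action oc_group oc_cover;
  oc_effective : effective_on oc_act [set: oc_group]%G [set: oc_cover];
  oc_proj : oc_cover -> X;
  oc_proj_continuous : continuous oc_proj;
  oc_proj_invariant : forall g x, oc_proj (oc_act g x) = oc_proj x;
  oc_proj_homeo : exists f : orbit_space oc_act -> X,
    [/\ forall x, f (orbit_proj oc_act x) = oc_proj x,
        topological_embedding f & range f = oc_dom]
}.

Section Orbifolds.
Variables (R : realType) (n : nat).

Definition orbichart_injection (X : topologicalType) (c d : orbichart R n X)
    (l : oc_cover c -> oc_cover d) : Prop :=
  [/\ oc_dom c `<=` oc_dom d, smooth_embedding l &
      forall x, oc_proj (l x) = oc_proj x].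

Definition orbichart_compatible_at (X : topologicalType)
    (c d : orbichart R n X) (p : X) : Prop :=
  exists e : orbichart R n X,
    [/\ oc_dom e p, oc_dom e `<=` oc_dom c `&` oc_dom d,
        exists l : oc_cover e -> oc_cover c, orbichart_injection l &
        exists l : oc_cover e -> oc_cover d, orbichart_injection l].

(* Atlases are plain predicates because orbichart lives in a universe above the
   one accepted by [set]. *)
Definition orbifold_atlas (X : topologicalType) (A : orbichart R n X -> Prop) :
    Prop :=
  (forall p, exists2 c, A c & oc_dom c p) /\
  (forall c d, A c -> A d ->
    forall p, oc_dom c p -> oc_dom d p -> orbichart_compatible_at c d p).

Record orbifold := Orbifold {
  o_space :> topologicalType;
  o_hausdorff : hausdorff_space o_space;
  o_second_countable : @second_countable o_space;
  o_chart : orbichart R n o_space -> Prop;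
  o_chart_atlas : orbifold_atlas o_chart;
  o_chart_maximal : forall B : orbichart R n o_space -> Prop,
    orbifold_atlas B -> (forall c, o_chart c -> B c) ->
    forall c, B c -> o_chart c
}.

Definition embedded_suborbifold (O : orbifold) (k : nat) (P : set O) : Prop :=
  (k <= n)%N /\
  forall p, P p ->
    exists c : orbichart R n O, o_chart c /\
    exists (D : {group oc_group c}) (V : set (oc_cover c)),
      [/\ connected V, H_submanifold (oc_act c) k D V,
          open_neighborhood_in P p (@oc_proj _ _ _ c @` V) &
          effective_on (oc_act c) D V].

End Orbifolds.

(* The canonical projection H -> H / K has a right inverse that is a group
   homomorphism (for K normal in H). *)
Definition quotient_splits (gT : finGroupType) (H K : {group gT}) : Prop :=
  exists s : {morphism (H / K)%g >-> gT},
    forall q, q \in (H / K)%g -> s q \in H /\ coset K (s q) = q.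

(* Main.v *)
(* A homomorphic section of Delta -> Delta/K has as image a complement of K in
   Delta. This complement has the same orbits on V as Delta, because K acts
   trivially on V, and it acts effectively because it meets K trivially; so
   replacing Delta by it turns (ii) into (i) without changing the chart or V. *)
Require Import Defs.
From mathcomp Require Import all_boot all_order all_algebra all_fingroup.
From mathcomp Require Import all_classical all_reals all_analysis.

Local Open Scope classical_set_scope.

(** With trivial kernel [coset K] is injective, so its inverse, restricted from the image of ['N(K)]
    to [H / K], is the section. *)
Lemma quotient_splits_trivg (gT : finGroupType) (H K : {group gT}) :
  K :=: 1%g -> quotient_splits H K.
Proof.
move=> K1.
have injK : ('injm (coset K))%g by rewrite ker_coset K1.
have nKH : (H \subset 'N(K))%g by rewrite K1 norms1.
have sHN : ((H / K)%g \subset coset K @* 'N(K))%g by apply: morphimS.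
exists (restrm_morphism sHN (invm_morphism injK)) => q.
move=> /morphimP[h Nh Hh ->]; rewrite /= /restrm.
by rewrite (invmE injK Nh).
Qed.

Section KernelOfHSubmanifold.
Variables (R : realType) (n k : nat) (gT : finGroupType) (M : manifold R n).
Variables (a : smooth_action gT M) (H : {group gT}) (N : set M).
Hypothesis HN : H_submanifold a k H N.

Lemma H_submanifold_stable h x : h \in H -> N x -> N (a h x).
Proof.
move=> Hh Nx; have [_ /(_ x Nx) orb] := HN.
have : act_orbit a H x (a h x) by exists h.
by rewrite -orb => -[].
Qed.

(** Normality rests on [H] preserving [N]. It puts [H] inside ['N(K)], where [coset K] is
    multiplicative. *)
Lemma act_kernel_norm : (H \subset 'N(act_kernel a H N))%g.
Proof.
apply/fintype.subsetP => g Hg; rewrite inE; apply/fintype.subsetP => h.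
rewrite mem_conjg !inE => /andP[Hhg /asboolP fix_hg].
move: Hhg; rewrite groupJr ?groupV// => -> /=; apply/asboolP => x Nx.
(* The conjugate [g * h * g^-1] fixes the point [a g x] of [N]; cancelling [g] shows that [h] fixes
   [x]. *)
have := congr1 (a g^-1)%g (fix_hg _ (H_submanifold_stable _ _ Hg Nx)).
by rewrite -!sa_M conjgE invgK !mulgA mulVg mul1g -mulgA mulVg mulg1 sa_1.
Qed.

End KernelOfHSubmanifold.

Lemma splitting_effective_subgroup (R : realType) (n k : nat)
    (gT : finGroupType) (M : manifold R n) (a : smooth_action gT M)
    (H : {group gT}) (N : set M) :
  H_submanifold a k H N -> quotient_splits H (act_kernel_group a H N) ->
  exists L : {group gT}, H_submanifold a k L N /\ effective_on a L N.
Proof.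
move=> HN [s sP]; set K := act_kernel_group a H N.
have nKH : (H \subset 'N(K))%g by apply: act_kernel_norm HN.
exists [group of s @* (H / K)]%g; split; last first.
  (* If [s q] fixes [N] pointwise, it lies in [K], so [q = coset K (s q)] is trivial. *)
  move=> h /morphimP[q Hq _ ->] fixq; have [Hsq sqK] := sP q Hq.
  have Ksq : s q \in K by rewrite inE Hsq; apply/asboolP.
  by rewrite -sqK (coset_id Ksq) morph1.
have [subN orb] := HN; split => // x Nx; rewrite orb//.
apply/seteqP; split => y [h].
  move=> Hh ->; set q := coset K h.
  have Hq : q \in (H / K)%g by apply: mem_quotient.
  have [Hsq sqK] := sP q Hq.
  exists (s q); first exact: mem_morphim.
  (* Both [h] and [s q] lie over [q], so they differ by a right factor in [K], which fixes [x];
     hence they move [x] to the same point. *)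
  have : ((s q)^-1 * h)%g \in K.
    have Nsq := fintype.subsetP nKH _ Hsq.
    have Nh := fintype.subsetP nKH _ Hh.
    apply: coset_idr; first by rewrite groupM ?groupV.
    by rewrite morphM ?groupV// morphV// /= sqK mulVg.
  rewrite inE => /andP[_ /asboolP/(_ x Nx) fixx].
  by rewrite -[in RHS]fixx -sa_M mulgA mulgV mul1g.
by move=> /morphimP[q Hq _ ->] ->; exists (s q) => //; case: (sP q Hq).
Qed.

Theorem proposition5p5 (R : realType) (n : nat) (O : orbifold R n) (k : nat)
    (hk : (k <= n)%N) (P : set O) :
  embedded_suborbifold k P <->
  (forall p : O, P p ->
    exists c : orbichart R n O, o_chart c /\
    exists (D : {group oc_group c}) (V : set (oc_cover c)),
      [/\ connected V, H_submanifold (oc_act c) k D V,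
          open_neighborhood_in P p (@oc_proj R n O c @` V) &
          quotient_splits D (act_kernel_group (oc_act c) D V)]).
Proof.
split=> [[_ subP] p Pp|chartP].
  have [c [Oc [D [V [cV DV pV eff]]]]] := subP p Pp.
  exists c; split=> //; exists D, V; split=> //.
  (* Effectiveness of [D] on [V] says exactly that the kernel is trivial. *)
  apply: quotient_splits_trivg; apply/trivgP/fintype.subsetP => h.
  by rewrite !inE => /andP[Dh /asboolP/(eff h Dh)->].
split=> // p Pp; have [c [Oc [D [V [cV DV pV splits]]]]] := chartP p Pp.
have [L [LV eff]] := splitting_effective_subgroup _ _ _ _ _ _ _ _ DV splits.
by exists c; split=> //; exists L, V.
Qed.
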